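(* Fix an extended type $\tau=(\tau_1,\tau_2)$. Let $\mathbf{Lat}^*$ be the category of complete lattices whose morphisms are maps preserving $0,1$, arbitrary joins and arbitrary meets; let $\mathbf{Rel}_\tau$ be the category of extended relational structures of type $\tau$ with $p$-morphisms; and let $\mathbf{Alg}_\tau$ be the category of bounded lattices with families of additional operations of types $\tau_1$ and $\tau_2$ and their homomorphisms. Then $(L,\mathfrak{X})\mapsto L^{\mathfrak{X}*}$, sending $\phi:L\to M$ to $\alpha\mapsto\phi\circ\alpha$ and a $p$-morphism $p:\mathfrak{X}\to\mathfrak{Y}$ to $\beta\mapsto\beta\circ p$ (from $L^{\mathfrak{Y}*}$ to $L^{\mathfrak{X}*}$), is a bifunctor $\mathbf{Lat}^*\times\mathbf{Rel}_\tau\to\mathbf{Alg}_\tau$, covariant in the first argument and contravariant in the second. It preserves products in the first argument ($(\prod_J L_j)^{\mathfrak{X}*}\cong\prod_J L_j^{\mathfrak{X}*}$), takes coproducts (disjoint unions) to products in the second argument, $\alpha\mapsto\phi\circ\alpha$ is one-one (onto) whenever $\phi$ is, with the converse holding when $X$ is nonempty, and if a $p$-morphism $p$ is one-one (onto) then $\beta\mapsto\beta\circ p$ is onto (one-one).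
   Context: An extended type is a pair $\tau=(\tau_1,\tau_2)$ of types $\tau_1:I\to\mathbb{N}$, $\tau_2:J\to\mathbb{N}$, with arities $n_i$, $n_j$. An extended relational structure of type $\tau$ is $\mathfrak{X}=(X,(R_i)_{i\in I},(S_j)_{j\in J})$ with $R_i\subseteq X^{n_i+1}$, $S_j\subseteq X^{n_j+1}$. For a complete lattice $L$, $L^{\mathfrak{X}*}$ is $L^X$ with pointwise $\wedge,\vee,0,1$ and operations $f_i(\alpha_1,\ldots,\alpha_{n_i})(x)=\bigvee\{\alpha_1(x_1)\wedge\cdots\wedge\alpha_{n_i}(x_{n_i}):(x_1,\ldots,x_{n_i},x)\in R_i\}$ and $g_j(\alpha_1,\ldots,\alpha_{n_j})(x)=\bigwedge\{\alpha_1(x_1)\vee\cdots\vee\alpha_{n_j}(x_{n_j}):(x_1,\ldots,x_{n_j},x)\in S_j\}$. A $p$-morphism $p:X\to Y$ between extended relational structures $(X,(R_i),(S_j))$, $(Y,(R_i'),(S_j'))$ satisfies, for every relation index $k$ (of either family) with corresponding relations $T_k$ on $X$, $T_k'$ on $Y$ of arity $n_k+1$ and every $x\in X$: $\{(y_1,\ldots,y_{n_k}):(y_1,\ldots,y_{n_k},p(x))\in T_k'\}=\{(p(x_1),\ldots,p(x_{n_k})):(x_1,\ldots,x_{n_k},x)\in T_k\}$. The coproduct is disjoint union with relations taken as unions. *)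

(* Defs.v *)
From HB Require Import structures.
From mathcomp Require Import all_boot all_order.
From mathcomp Require Import boolp classical_sets.

Set Implicit Arguments.
Unset Strict Implicit.
Unset Printing Implicit Defensive.

Import Order.Theory.
Local Open Scope order_scope.
Local Open Scope classical_set_scope.

Definition onto (A B : Type) (f : A -> B) : Prop := forall b, exists a, f a = b.

Record category := Category {
  obj :> Type;
  hom : obj -> obj -> Type;
  idm : forall a, hom a a;
  compm : forall a b c, hom b c -> hom a b -> hom a c;
  comp1m : forall a b (f : hom a b), compm (idm b) f = f;
  compm1 : forall a b (f : hom a b), compm f (idm a) = f;
  compmA : forall a b c e (h : hom c e) (g : hom b c) (f : hom a b),
    compm h (compm g f) = compm (compm h g) f }.

Arguments idm {_} _.

Definition op_category (C : category) : category :=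
  @Category C (fun a b => hom b a) (@idm C) (fun a b c g f => compm f g)
    (fun a b f => compm1 f) (fun a b f => comp1m f)
    (fun a b c e h g f => esym (compmA f g h)).

Section ProdCategory.
Variables C D : category.

Let phom (a b : C * D) : Type := (hom a.1 b.1 * hom a.2 b.2)%type.
Let pid (a : C * D) : phom a a := (idm a.1, idm a.2).
Let pcomp (a b c : C * D) (g : phom b c) (f : phom a b) : phom a c :=
  (compm g.1 f.1, compm g.2 f.2).

Fact prod_comp1m a b (f : phom a b) : pcomp (pid b) f = f.
Proof. by case: f => f1 f2; rewrite /pcomp /= !comp1m. Qed.

Fact prod_compm1 a b (f : phom a b) : pcomp f (pid a) = f.
Proof. by case: f => f1 f2; rewrite /pcomp /= !compm1. Qed.

Fact prod_compmA a b c e (h : phom c e) (g : phom b c) (f : phom a b) :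
  pcomp h (pcomp g f) = pcomp (pcomp h g) f.
Proof. by rewrite /pcomp /= !compmA. Qed.

Definition prod_category : category :=
  Category prod_comp1m prod_compm1 prod_compmA.
End ProdCategory.

(* The object map is a parameter, so that a functor with a prescribed object
   map can be quantified over without transporting along equalities of
   objects. *)
Record functor (C D : category) (Fo : C -> D) := Functor {
  fmap : forall a b : C, hom a b -> hom (Fo a) (Fo b);
  fmap_id : forall a, fmap (idm a) = idm (Fo a);
  fmap_comp : forall a b c (g : hom b c) (f : hom a b),
    fmap (compm g f) = compm (fmap g) (fmap f) }.

Section Bifunctor.
Variables (C D E : category).
Variable Fo : prod_category C (op_category D) -> E.
Variable F : functor Fo.

Definition fmapl (a a' : C) (f : hom a a') (b : D) :
    hom (Fo (a, b)) (Fo (a', b)) :=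
  @fmap _ _ _ F (a, b) (a', b) (f, idm b).

Definition fmapr (a : C) (b b' : D) (g : hom b b') :
    hom (Fo (a, b')) (Fo (a, b)) :=
  @fmap _ _ _ F (a, b') (a, b) (idm a, g).
End Bifunctor.

Section Limits.
Variable C : category.

Definition is_iso (a b : C) (f : hom a b) : Prop :=
  exists g : hom b a, compm g f = idm a /\ compm f g = idm b.

Definition is_product (K : Type) (A : K -> C) (P : C)
    (pr : forall k, hom P (A k)) : Prop :=
  forall (Q : C) (q : forall k, hom Q (A k)),
    exists! h : hom Q P, forall k, compm (pr k) h = q k.

Definition is_coproduct (K : Type) (A : K -> C) (S : C)
    (inj : forall k, hom (A k) S) : Prop :=
  forall (Q : C) (q : forall k, hom (A k) Q),
    exists! h : hom S Q, forall k, compm h (inj k) = q k.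
End Limits.

HB.mixin Record TBLattice_isComplete d L of Order.TBLattice d L := {
  supremums_neq0 : forall A : set L, supremums A !=set0;
  infimums_neq0 : forall A : set L, infimums A !=set0
}.

#[short(type="completeLatticeType")]
HB.structure Definition CompleteLattice d :=
  { L of TBLattice_isComplete d L & Order.TBLattice d L }.

(* [supremum x0 A] is [x0] on the empty set, hence the default values. *)
Definition lsup d (L : completeLatticeType d) (A : set L) : L := supremum \bot A.
Definition linf d (L : completeLatticeType d) (A : set L) : L := infimum \top A.

Section LatStar.

Record lat_obj := LatObj {
  lat_disp : Order.disp_t;
  lat_sort :> completeLatticeType lat_disp }.

Record lat_hom (L M : lat_obj) := LatHom {
  lat_map :> L -> M;
  lat_map0 : lat_map \bot = \bot;
  lat_map1 : lat_map \top = \top;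
  lat_map_sup : forall A : set L, lat_map (lsup A) = lsup (lat_map @` A);
  lat_map_inf : forall A : set L, lat_map (linf A) = linf (lat_map @` A) }.

Lemma lat_hom_ext L M (f g : lat_hom L M) : f =1 g -> f = g.
Proof.
case: f g => [f f0 f1 fs fi] [g g0 g1 gs gi] /= /funext fg.
by case: _ / fg in g0 g1 gs gi *; congr LatHom; exact: Prop_irrelevance.
Qed.

Definition lat_id (L : lat_obj) : lat_hom L L.
Proof. by exists id => // A; rewrite image_id. Defined.

Definition lat_comp (L M N : lat_obj) (g : lat_hom M N) (f : lat_hom L M) :
  lat_hom L N.
Proof.
exists (g \o f) => [||A|A] /=.
- by rewrite !lat_map0.
- by rewrite !lat_map1.
- by rewrite !lat_map_sup image_comp.
- by rewrite !lat_map_inf image_comp.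
Defined.

Definition LatStar : category.
Proof.
by refine (@Category lat_obj lat_hom lat_id lat_comp _ _ _);
  intros; exact: lat_hom_ext.
Defined.
End LatStar.

Record extended_type := ExtendedType {
  idx1 : Type;
  idx2 : Type;
  ar1 : idx1 -> nat;
  ar2 : idx2 -> nat }.

Section Rel.
Variable tau : extended_type.

(* A subset of X^(n+1) is given as a subset of X^n * X, the tuple
   (x_1, ..., x_n, x) being split as ((x_1, ..., x_n), x). *)
Record rel_obj := RelObj {
  rel_sort :> Type;
  rel1 : forall i : idx1 tau, set (('I_(ar1 i) -> rel_sort) * rel_sort);
  rel2 : forall j : idx2 tau, set (('I_(ar2 j) -> rel_sort) * rel_sort) }.

Definition p_condition (X Y : Type) (n : nat) (p : X -> Y)
    (T : set (('I_n -> X) * X)) (T' : set (('I_n -> Y) * Y)) : Prop :=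
  forall x : X, [set ys | T' (ys, p x)] = [set p \o xs | xs in [set xs | T (xs, x)]].

Record rel_hom (X Y : rel_obj) := RelHom {
  rel_map :> X -> Y;
  rel_map1 : forall i, p_condition rel_map (@rel1 X i) (@rel1 Y i);
  rel_map2 : forall j, p_condition rel_map (@rel2 X j) (@rel2 Y j) }.

Lemma rel_hom_ext X Y (f g : rel_hom X Y) : f =1 g -> f = g.
Proof.
case: f g => [f f1 f2] [g g1 g2] /= /funext fg.
by case: _ / fg in g1 g2 *; congr RelHom; exact: Prop_irrelevance.
Qed.

Lemma p_condition_id X n (T : set (('I_n -> X) * X)) : p_condition id T T.
Proof. by move=> x; rewrite image_id. Qed.

Lemma p_condition_comp X Y Z n (p : X -> Y) (q : Y -> Z)
    (T : set (('I_n -> X) * X)) T' T'' :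
  p_condition p T T' -> p_condition q T' T'' -> p_condition (q \o p) T T''.
Proof. by move=> pT qT x; rewrite [LHS]qT pT image_comp. Qed.

Definition rel_id (X : rel_obj) : rel_hom X X :=
  @RelHom X X id (fun i => @p_condition_id _ _ _) (fun j => @p_condition_id _ _ _).

Definition rel_comp (X Y Z : rel_obj) (q : rel_hom Y Z) (p : rel_hom X Y) :
    rel_hom X Z :=
  @RelHom X Z (q \o p)
    (fun i => p_condition_comp (rel_map1 p i) (rel_map1 q i))
    (fun j => p_condition_comp (rel_map2 p j) (rel_map2 q j)).

Definition Rel : category.
Proof.
by refine (@Category rel_obj rel_hom rel_id rel_comp _ _ _);
  intros; exact: rel_hom_ext.
Defined.

Definition disjoint_union (K : Type) (X : K -> Rel) : Rel :=
  @RelObj {k : K & X k}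
    (fun i => \bigcup_k
      [set (existT X k \o t.1, existT X k t.2) | t in @rel1 (X k) i])
    (fun j => \bigcup_k
      [set (existT X k \o t.1, existT X k t.2) | t in @rel2 (X k) j]).
End Rel.

Section Alg.
Variable tau : extended_type.

Record alg_obj := AlgObj {
  alg_disp : Order.disp_t;
  alg_sort :> tbLatticeType alg_disp;
  alg_op1 : forall i : idx1 tau, ('I_(ar1 i) -> alg_sort) -> alg_sort;
  alg_op2 : forall j : idx2 tau, ('I_(ar2 j) -> alg_sort) -> alg_sort }.

Record alg_hom (A B : alg_obj) := AlgHom {
  alg_map :> A -> B;
  alg_map0 : alg_map \bot = \bot;
  alg_map1 : alg_map \top = \top;
  alg_mapI : {morph alg_map : x y / (x `&` y)%O};
  alg_mapU : {morph alg_map : x y / (x `|` y)%O};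
  alg_map_op1 : forall i a, alg_map (@alg_op1 A i a) = @alg_op1 B i (alg_map \o a);
  alg_map_op2 : forall j a, alg_map (@alg_op2 A j a) = @alg_op2 B j (alg_map \o a) }.

Lemma alg_hom_ext A B (f g : alg_hom A B) : f =1 g -> f = g.
Proof.
case: f g => [f f0 f1 fI fU fo1 fo2] [g g0 g1 gI gU go1 go2] /= /funext fg.
by case: _ / fg in g0 g1 gI gU go1 go2 *; congr AlgHom; exact: Prop_irrelevance.
Qed.

Definition alg_id (A : alg_obj) : alg_hom A A.
Proof. by exists id. Defined.

Definition alg_comp (A B C : alg_obj) (g : alg_hom B C) (f : alg_hom A B) :
  alg_hom A C.
Proof.
exists (g \o f) => [||x y|x y|i a|j a] /=.
- by rewrite !alg_map0.
- by rewrite !alg_map1.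
- by rewrite !alg_mapI.
- by rewrite !alg_mapU.
- by rewrite !alg_map_op1.
- by rewrite !alg_map_op2.
Defined.

Definition Alg : category.
Proof.
by refine (@Category alg_obj alg_hom alg_id alg_comp _ _ _);
  intros; exact: alg_hom_ext.
Defined.
End Alg.

(* [X -> L] carries the pointwise lattice structure of [mathcomp.classical];
   only the bounds are missing there. *)
Section FunBounds.
Variables (X : Type) (d : Order.disp_t) (L : tbLatticeType d).

Fact fun_le0x (f : X -> L) : (fun=> \bot) <= f.
Proof. by apply/lefP => x; exact: le0x. Qed.

Fact fun_lex1 (f : X -> L) : f <= (fun=> \top).
Proof. by apply/lefP => x; exact: lex1. Qed.

HB.instance Definition _ :=
  Order.hasBottom.Build FunOrder.fun_display (X -> L) fun_le0x.
HB.instance Definition _ :=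
  Order.hasTop.Build FunOrder.fun_display (X -> L) fun_lex1.
End FunBounds.

Definition complex_algebra (tau : extended_type) (L : LatStar) (X : Rel tau) :
    Alg tau :=
  @AlgObj tau FunOrder.fun_display (X -> L : tbLatticeType _)
    (fun i alpha x =>
       lsup [set \meet_(k < ar1 i) alpha k (xs k) | xs in [set xs | @rel1 _ X i (xs, x)]])
    (fun j alpha x =>
       linf [set \join_(k < ar2 j) alpha k (xs k) | xs in [set xs | @rel2 _ X j (xs, x)]]).

(* A separate carrier, since an instance on dependent function types would
   compete with the one on [X -> L]. *)
Definition dprod (K : Type) (T : K -> Type) : Type := forall k, T k.

HB.instance Definition _ (K : Type) (T : K -> Type) := gen_eqMixin (dprod T).
HB.instance Definition _ (K : Type) (T : K -> Type) := gen_choiceMixin (dprod T).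

Section DProdLattice.
Variables (K : Type) (d : K -> Order.disp_t) (A : forall k, tbLatticeType (d k)).
Implicit Types f g h : dprod A.

Definition dprod_le f g : bool := `[< forall k, f k <= g k >].

Fact dprod_le_refl : reflexive dprod_le.
Proof. by move=> f; apply/asboolP => k. Qed.

Fact dprod_le_anti : antisymmetric dprod_le.
Proof.
move=> f g /andP[/asboolP fg /asboolP gf]; apply: functional_extensionality_dep.
by move=> k; apply/eqP; rewrite eq_le fg gf.
Qed.

Fact dprod_le_trans : transitive dprod_le.
Proof.
by move=> g f h /asboolP fg /asboolP gh; apply/asboolP => k; rewrite (le_trans (fg k)).
Qed.

HB.instance Definition _ := Order.Le_isPOrder.Build FunOrder.fun_display (dprod A)
  dprod_le_refl dprod_le_anti dprod_le_trans.

Lemma dprod_leP f g : reflect (forall k, f k <= g k) (f <= g).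
Proof. exact: asboolP. Qed.

Definition dprod_meet f g : dprod A := fun k => (f k `&` g k)%O.
Definition dprod_join f g : dprod A := fun k => (f k `|` g k)%O.
Definition dprod_bot : dprod A := fun=> \bot.
Definition dprod_top : dprod A := fun=> \top.

Fact dprod_lexI h f g : (h <= dprod_meet f g) = (h <= f) && (h <= g).
Proof.
apply/dprod_leP/andP => [le|[/dprod_leP hf /dprod_leP hg] k].
  by split; apply/dprod_leP => k; have := le k; rewrite lexI => /andP[].
by rewrite lexI hf hg.
Qed.

Fact dprod_leUx f g h : (dprod_join f g <= h) = (f <= h) && (g <= h).
Proof.
apply/dprod_leP/andP => [le|[/dprod_leP hf /dprod_leP hg] k].
  by split; apply/dprod_leP => k; have := le k; rewrite leUx => /andP[].
by rewrite leUx hf hg.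
Qed.

HB.instance Definition _ := Order.POrder_isMeetSemilattice.Build
  FunOrder.fun_display (dprod A) dprod_lexI.
HB.instance Definition _ := Order.POrder_isJoinSemilattice.Build
  FunOrder.fun_display (dprod A) dprod_leUx.

Fact dprod_le0x f : dprod_bot <= f.
Proof. by apply/dprod_leP => k; exact: le0x. Qed.
Fact dprod_lex1 f : f <= dprod_top.
Proof. by apply/dprod_leP => k; exact: lex1. Qed.

HB.instance Definition _ :=
  Order.hasBottom.Build FunOrder.fun_display (dprod A) dprod_le0x.
HB.instance Definition _ :=
  Order.hasTop.Build FunOrder.fun_display (dprod A) dprod_lex1.
End DProdLattice.

Section LatProduct.
Variables (K : Type) (L : K -> lat_obj).

Fact dprod_supremums_neq0 (A : set (dprod L)) : supremums A !=set0.
Proof.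
pose s k := sval (cid (supremums_neq0 [set f k | f in A])).
have sP k : supremums [set f k | f in A] (s k) by exact: svalP.
exists s; split => [f Af|f Af]; apply/dprod_leP => k; have [ub lub] := sP k.
  by apply: ub; exists f.
by apply: lub => _ [g Ag <-]; move/dprod_leP: (Af _ Ag); exact.
Qed.

Fact dprod_infimums_neq0 (A : set (dprod L)) : infimums A !=set0.
Proof.
pose s k := sval (cid (infimums_neq0 [set f k | f in A])).
have sP k : infimums [set f k | f in A] (s k) by exact: svalP.
exists s; split => [f Af|f Af]; apply/dprod_leP => k; have [lb glb] := sP k.
  by apply: lb; exists f.
by apply: glb => _ [g Ag <-]; move/dprod_leP: (Af _ Ag); exact.
Qed.

HB.instance Definition _ := TBLattice_isComplete.Build FunOrder.fun_display
  (dprod L) dprod_supremums_neq0 dprod_infimums_neq0.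

Definition lat_product : LatStar :=
  @LatObj FunOrder.fun_display (dprod L : completeLatticeType _).
End LatProduct.

Definition alg_product (tau : extended_type) (K : Type) (A : K -> Alg tau) :
    Alg tau :=
  @AlgObj tau FunOrder.fun_display (dprod A : tbLatticeType _)
    (fun i a k => @alg_op1 _ (A k) i (fun m => a m k))
    (fun j a k => @alg_op2 _ (A k) j (fun m => a m k)).

(* Main.v *)
Require Import Defs.
From mathcomp Require Import all_boot all_order.
From mathcomp Require Import boolp classical_sets.

(** All the product statements reduce to one criterion: a family of
    homomorphisms [pr k : P -> A k] which is jointly bijective (every choice of
    elements of the [A k] is hit by exactly one element of [P]) makes [P] a
    product in [Alg tau].  A product cone in [LatStar] is jointly bijective, by
    comparison with the explicit product; a coproduct cocone in [Rel tau] is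
    jointly bijective, by comparison with the disjoint union; and both
    properties pass to [L^X], pointwise for the former and by gluing functions
    for the latter. *)

Set Implicit Arguments.
Unset Strict Implicit.
Unset Printing Implicit Defensive.

Import Order.Theory.
Local Open Scope order_scope.
Local Open Scope classical_set_scope.

(** * Suprema and infima in complete lattices *)

Section CompleteLattices.
Variables (d : Order.disp_t) (L : completeLatticeType d).
Implicit Types (A : set L) (x y : L).

Lemma lsupP A : supremums A (lsup A).
Proof.
(* On the empty set the value is the default [\bot], which is indeed its least upper bound. *)
rewrite /lsup /supremum; case: eqP => [->|_].
  by split=> [//|y _]; exact: le0x.
by case: xgetP => [y -> //|no]; have [y /no] := supremums_neq0 A.
Qed.

Lemma linfP A : infimums A (linf A).
Proof.
rewrite /linf /infimum; case: eqP => [->|_].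
  by split=> [//|y _]; exact: lex1.
by case: xgetP => [y -> //|no]; have [y /no] := infimums_neq0 A.
Qed.

Lemma lsup_unique A x : supremums A x -> lsup A = x.
Proof. by move=> Ax; apply: is_subset1_supremums (lsupP A) Ax. Qed.

Lemma linf_unique A x : infimums A x -> linf A = x.
Proof. by move=> Ax; apply: is_subset1_infimums (linfP A) Ax. Qed.

Lemma lsup2 x y : lsup [set x; y] = (x `|` y)%O.
Proof.
apply: lsup_unique; split=> [z [] ->|z ub]; rewrite ?leUl ?leUr //.
by rewrite leUx; apply/andP; split; apply: ub; [left|right].
Qed.

Lemma linf2 x y : linf [set x; y] = (x `&` y)%O.
Proof.
apply: linf_unique; split=> [z [] ->|z lb]; rewrite ?leIl ?leIr //.
by rewrite lexI; apply/andP; split; apply: lb; [left|right].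
Qed.
End CompleteLattices.

Section LatHoms.
Variables (L M : lat_obj) (phi : lat_hom L M).

(** A binary join is the supremum of a pair, so preservation of arbitrary suprema covers it. *)
Lemma lat_mapU : {morph phi : x y / (x `|` y)%O}.
Proof. by move=> x y; rewrite -!lsup2 lat_map_sup image_setU !image_set1. Qed.

Lemma lat_mapI : {morph phi : x y / (x `&` y)%O}.
Proof. by move=> x y; rewrite -!linf2 lat_map_inf image_setU !image_set1. Qed.

(** Arity 0 gives the empty meet [\top], which is where [lat_map1] enters. *)
Lemma lat_map_bigmeet n (a : 'I_n -> L) :
  phi (\meet_(k < n) a k) = \meet_(k < n) phi (a k).
Proof. exact: (big_morph phi lat_mapI (lat_map1 phi)). Qed.

Lemma lat_map_bigjoin n (a : 'I_n -> L) :
  phi (\join_(k < n) a k) = \join_(k < n) phi (a k).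
Proof. exact: (big_morph phi lat_mapU (lat_map0 phi)). Qed.
End LatHoms.

(** * Products of complete lattices *)

Section LatProducts.
Variables (K : Type) (L : K -> LatStar).

Lemma lsup_dprod (A : set (lat_product L)) (k : K) :
  lsup A k = lsup [set f k | f in A].
Proof.
(* All coordinates are treated at once, so that uniqueness of suprema in the product lattice
   applies. *)
rewrite (_ : lsup A = (fun k => lsup [set f k | f in A]) :> lat_product L) //.
apply: lsup_unique; split=> [f Af|f ub]; apply/dprod_leP => m.
  by have [lub _] := lsupP [set g m | g in A]; apply: lub; exists f.
have [_] := lsupP [set g m | g in A]; apply => _ [g Ag <-].
by have /dprod_leP := ub _ Ag; exact.
Qed.

Lemma linf_dprod (A : set (lat_product L)) (k : K) :
  linf A k = linf [set f k | f in A].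
Proof.
rewrite (_ : linf A = (fun k => linf [set f k | f in A]) :> lat_product L) //.
apply: linf_unique; split=> [f Af|f lb]; apply/dprod_leP => m.
  by have [glb _] := linfP [set g m | g in A]; apply: glb; exists f.
have [_] := linfP [set g m | g in A]; apply => _ [g Ag <-].
by have /dprod_leP := lb _ Ag; exact.
Qed.

Definition lat_proj (k : K) : lat_hom (lat_product L) (L k) :=
  @LatHom (lat_product L) (L k) (fun f => f k) erefl erefl
    (fun A => lsup_dprod A k) (fun A => linf_dprod A k).

Definition lat_tuple (P : LatStar) (pr : forall k, lat_hom P (L k)) :
  lat_hom P (lat_product L).
Proof.
exists (fun x k => pr k x) => [||A|A]; apply: functional_extensionality_dep => k.
- exact: lat_map0.
- exact: lat_map1.
- by rewrite lsup_dprod lat_map_sup image_comp.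
- by rewrite linf_dprod lat_map_inf image_comp.
Defined.

(** The mediating map [h] from the explicit product to [P] is inverse to [lat_tuple pr], so elements
    of [P] correspond to families. *)
Lemma lat_product_bij (P : LatStar) (pr : forall k, hom P (L k)) :
  is_product pr ->
  forall l : (forall k, L k), exists! x : P, forall k, (pr k : lat_hom _ _) x = l k.
Proof.
move=> prP l; have [h [hE _]] := prP (lat_product L) lat_proj.
have hK k f : (pr k : lat_hom _ _) ((h : lat_hom _ _) f) = f k.
  exact: (congr1 (fun u : lat_hom _ _ => u f) (hE k)).
have Kh (x : P) : (h : lat_hom _ _) (lat_tuple pr x) = x.
  have [u [_ uni]] := prP P pr.
  (* This endomorphism commutes with every [pr k], as does the identity; uniqueness at [P] makes
     them equal. *)
  pose hpr : hom P P := compm (h : hom (lat_product L) P) (lat_tuple pr).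
  have hprE : hpr = idm P.
    rewrite -(uni hpr) ?(uni (idm P)) // => k; first by rewrite compm1.
    by apply: lat_hom_ext => y; exact: hK.
  exact: (congr1 (fun v : lat_hom P P => v x) hprE).
exists ((h : lat_hom _ _) (l : lat_product L)); split=> [k|x xl]; first exact: hK.
rewrite -[RHS]Kh; congr ((h : lat_hom _ _) _).
by apply: functional_extensionality_dep => k; rewrite /= xl.
Qed.
End LatProducts.

(** * Coproducts of relational structures *)

Section DisjointUnions.
Variables (tau : extended_type) (K : Type) (X : K -> Rel tau).

(** Since [z] is a variable, its equation with [existT X k x] is substituted away, and injectivity
    of [existT] is avoided. *)
Lemma bigcup_existTP n (T : forall k, set (('I_n -> X k) * X k)) zs
    (z : disjoint_union X) :
  (\bigcup_k [set (existT X k \o t.1, existT X k t.2) | t in T k]) (zs, z) <->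
  exists2 xs, T (tag z) (xs, tagged z) & existT X (tag z) \o xs = zs.
Proof.
split=> [[k _ [[xs x] Tx [<- <-]]]|[xs Txs <-]]; first by exists xs.
by case: z xs Txs => k x xs Txs; exists k => //; exists (xs, x).
Qed.

Lemma p_condition_existT n (T : forall k, set (('I_n -> X k) * X k)) k :
  p_condition (existT X k) (T k)
    (\bigcup_k [set (existT X k \o t.1, existT X k t.2) | t in T k]).
Proof.
move=> x; apply/funext => zs; apply/propext.
exact: (bigcup_existTP T zs (existT X k x)).
Qed.

(** At a point of the [k]-th summand, the tuples related to it in the union are the images under
    [existT X k] of those in [X k], so the condition reduces to that of [f k]. *)
Lemma p_condition_cotuple (S : Type) n (T : forall k, set (('I_n -> X k) * X k))
    (T' : set (('I_n -> S) * S)) (f : forall k, X k -> S) :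
  (forall k, p_condition (f k) (T k) T') ->
  p_condition (fun z : disjoint_union X => f (tag z) (tagged z))
    (\bigcup_k [set (existT X k \o t.1, existT X k t.2) | t in T k]) T'.
Proof.
by move=> fP [k x]; rewrite [LHS]fP (p_condition_existT T x) image_comp.
Qed.

Definition rel_inj (k : K) : rel_hom (X k) (disjoint_union X) :=
  @RelHom tau (X k) (disjoint_union X) (existT X k)
    (fun i => p_condition_existT (fun k => @rel1 tau (X k) i) (k := k))
    (fun j => p_condition_existT (fun k => @rel2 tau (X k) j) (k := k)).

Definition rel_cotuple (S : Rel tau) (f : forall k, rel_hom (X k) S) :
    rel_hom (disjoint_union X) S :=
  @RelHom tau (disjoint_union X) S (fun z => f (tag z) (tagged z))
    (fun i => p_condition_cotuple (fun k => rel_map1 (f k) i))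
    (fun j => p_condition_cotuple (fun k => rel_map2 (f k) j)).

(** Dual to [lat_product_bij]: one equation is the factorization of [rel_inj] through [inj], the
    other is uniqueness of mediating maps from [S] to itself. *)
Lemma rel_coproduct_bij (S : Rel tau) (inj : forall k, hom (X k) S) :
  is_coproduct inj ->
  exists h : S -> disjoint_union X,
    cancel (fun z => (inj (tag z) : rel_hom _ _) (tagged z)) h /\
    cancel h (fun z => (inj (tag z) : rel_hom _ _) (tagged z)).
Proof.
move=> injP; have [h [hE _]] := injP (disjoint_union X) rel_inj.
exists (h : rel_hom _ _); split=> [[k x]|s].
  exact: (congr1 (fun u : rel_hom _ _ => u x) (hE k)).
have [u [_ uni]] := injP S inj.
pose ch : hom S S := compm (rel_cotuple inj : hom (disjoint_union X) S) h.
have chE : ch = idm S.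
  rewrite -(uni ch) ?(uni (idm S)) // => k; first by rewrite comp1m.
  by rewrite -compmA hE; exact: rel_hom_ext.
exact: (congr1 (fun v : rel_hom S S => v s) chE).
Qed.
End DisjointUnions.

(** * The product criterion for algebras *)

Section JointlyBijective.
Variables (tau : extended_type) (K : Type) (A : K -> Alg tau) (P : Alg tau).
Variable pr : forall k, alg_hom P (A k).
Hypothesis pr_bij :
  forall a : (forall k, A k), exists! x : P, forall k, pr k x = a k.

Let pr_inj (x y : P) : (forall k, pr k x = pr k y) -> x = y.
Proof.
by move=> xy; have [z [_ uni]] := pr_bij (fun k => pr k y); rewrite -(uni x) ?(uni y).
Qed.

Section Lift.
Variables (Q : Alg tau) (q : forall k, alg_hom Q (A k)).

Let lift (a : Q) : P := sval (cid (pr_bij (fun k => q k a))).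

Let pr_lift k a : pr k (lift a) = q k a.
Proof. exact: (svalP (cid (pr_bij (fun k => q k a)))).1. Qed.

Definition alg_lift : alg_hom Q P.
Proof.
(* Each law is an equation in [P], hence may be tested after every [pr k], where it follows from the
   law for [q k]. *)
exists lift => [||a b|a b|i a|j a]; apply: pr_inj => k.
- by rewrite pr_lift !alg_map0.
- by rewrite pr_lift !alg_map1.
- by rewrite pr_lift !alg_mapI !pr_lift.
- by rewrite pr_lift !alg_mapU !pr_lift.
- rewrite pr_lift !alg_map_op1; congr alg_op1.
  by apply/funext => m /=; rewrite pr_lift.
- rewrite pr_lift !alg_map_op2; congr alg_op2.
  by apply/funext => m /=; rewrite pr_lift.
Defined.

Lemma alg_liftE k a : pr k (alg_lift a) = q k a.
Proof. exact: pr_lift. Qed.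
End Lift.

Lemma alg_is_product : is_product (C := Alg tau) pr.
Proof.
move=> Q q; exists (alg_lift q); split=> [k|h hE].
  by apply: alg_hom_ext => a; exact: alg_liftE.
by apply: alg_hom_ext => a; apply: pr_inj => k; rewrite alg_liftE -hE.
Qed.

Definition alg_tuple : alg_hom P (alg_product A).
Proof.
exists (fun x k => pr k x) => [||x y|x y|i a|j a];
  apply: functional_extensionality_dep => k.
- exact: alg_map0.
- exact: alg_map1.
- exact: alg_mapI.
- exact: alg_mapU.
- exact: alg_map_op1.
- exact: alg_map_op2.
Defined.

Definition alg_proj k : alg_hom (alg_product A) (A k).
Proof. by exists (fun f => f k). Defined.

Lemma alg_tuple_iso : is_iso (C := Alg tau) alg_tuple.
Proof.
(* The inverse lifts the coordinate projections of the explicit product to [P]. *)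
exists (alg_lift alg_proj); split; apply: alg_hom_ext => a /=.
  by apply: pr_inj => k; rewrite [LHS]alg_liftE.
by apply: functional_extensionality_dep => k; exact: (alg_liftE alg_proj).
Qed.
End JointlyBijective.

(** * The bifunctor on morphisms, and joint bijectivity of its values *)

Section ComplexAlgebra.
Variable tau : extended_type.

Definition complex_hom (L M : LatStar) (X Y : Rel tau) (phi : lat_hom L M)
    (p : rel_hom X Y) : alg_hom (complex_algebra L Y) (complex_algebra M X).
Proof.
exists (fun beta => phi \o beta \o p) => [||a b|a b|i a|j a]; apply/funext => x /=.
- exact: lat_map0.
- exact: lat_map1.
- exact: lat_mapI.
- exact: lat_mapU.
(* The p-condition turns the tuples related to [p x] into images of those related to [x], so both
   sides are suprema over the same index set. *)
- rewrite lat_map_sup (rel_map1 p i x) !image_comp; congr lsup.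
  by apply: eq_imagel => xs _ /=; rewrite lat_map_bigmeet.
- rewrite lat_map_inf (rel_map2 p j x) !image_comp; congr linf.
  by apply: eq_imagel => xs _ /=; rewrite lat_map_bigjoin.
Defined.

Definition complex_functor :
  @functor (prod_category LatStar (op_category (Rel tau))) (Alg tau)
    (fun LX => complex_algebra LX.1 LX.2).
Proof.
exists (fun (a b : prod_category LatStar (op_category (Rel tau))) (f : hom a b) =>
          complex_hom (f.1 : lat_hom _ _) (f.2 : rel_hom _ _)).
  by move=> a; exact: alg_hom_ext.
by move=> a b c g f; exact: alg_hom_ext.
Defined.

(** The preimage is chosen separately at each point of [X]. The identity [rel_id X] makes the maps
    agree with [fmapl]. *)
Lemma complex_lat_bij (X : Rel tau) (K : Type) (L : K -> LatStar) (P : LatStar)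
    (pr : forall k, lat_hom P (L k)) :
  (forall l : (forall k, L k), exists! x : P, forall k, pr k x = l k) ->
  forall a : (forall k, complex_algebra (L k) X), exists! b : complex_algebra P X,
    forall k, complex_hom (pr k) (rel_id X) b = a k.
Proof.
move=> prP a; pose b x := cid (prP (fun k => a k x)).
exists (fun x => sval (b x)); split=> [k|c ca]; apply/funext => x /=.
  exact: (svalP (b x)).1.
by apply: (svalP (b x)).2 => k; rewrite -ca.
Qed.

(** A family of functions on the summands is one function on the disjoint union, carried to [S]
    along the bijection [h]. *)
Lemma complex_rel_bij (L : LatStar) (K : Type) (X : K -> Rel tau) (S : Rel tau)
    (inj : forall k, rel_hom (X k) S) (h : S -> disjoint_union X) :
  cancel (fun z => inj (tag z) (tagged z)) h ->
  cancel h (fun z => inj (tag z) (tagged z)) ->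
  forall a : (forall k, complex_algebra L (X k)), exists! b : complex_algebra L S,
    forall k, complex_hom (lat_id L) (inj k) b = a k.
Proof.
move=> injK hK a; exists (fun s => a (tag (h s)) (tagged (h s))).
split=> [k|b ba]; apply/funext => x /=.
  by rewrite (injK (existT X k x)).
by rewrite -ba /= hK.
Qed.

End ComplexAlgebra.

Theorem theorem5p9 (tau : extended_type) :
  exists F : @functor (prod_category LatStar (op_category (Rel tau))) (Alg tau)
               (fun LX => complex_algebra LX.1 LX.2),
  [/\ (* the action on morphisms *)
      (forall (L M : LatStar) (phi : lat_hom L M) (X : Rel tau) (alpha : X -> L),
         (fmapl F phi X : alg_hom _ _) alpha = phi \o alpha)
    /\ (forall (L : LatStar) (X Y : Rel tau) (p : rel_hom X Y) (beta : Y -> L),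
         (fmapr F L p : alg_hom _ _) beta = beta \o p),
      (* products in the first argument *)
      (forall (X : Rel tau) (K : Type) (L : K -> LatStar) (P : LatStar)
              (pr : forall k, hom P (L k)),
         is_product pr -> is_product (fun k => fmapl F (pr k) X))
    /\ (forall (X : Rel tau) (K : Type) (L : K -> LatStar),
         exists h : alg_hom (complex_algebra (lat_product L) X)
                            (alg_product (fun k => complex_algebra (L k) X)),
           is_iso (C := Alg tau) h /\
           forall (alpha : X -> lat_product L) (k : K),
             h alpha k = fun x => alpha x k),
      (* coproducts in the second argument *)
      (forall (L : LatStar) (K : Type) (X : K -> Rel tau) (S : Rel tau)
              (inj : forall k, hom (X k) S),
         is_coproduct inj -> is_product (fun k => fmapr F L (inj k)))
    /\ (forall (L : LatStar) (K : Type) (X : K -> Rel tau),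
         exists h : alg_hom (complex_algebra L (disjoint_union X))
                            (alg_product (fun k => complex_algebra L (X k))),
           is_iso (C := Alg tau) h /\
           forall (beta : disjoint_union X -> L) (k : K),
             h beta k = fun x => beta (existT (fun k => X k) k x)),
      (* injectivity and surjectivity in the first argument *)
      (forall (L M : LatStar) (phi : lat_hom L M) (X : Rel tau),
         [/\ injective phi -> injective (fmapl F phi X : alg_hom _ _),
             onto phi -> onto (fmapl F phi X : alg_hom _ _),
             inhabited X -> injective (fmapl F phi X : alg_hom _ _) ->
               injective phi
           & inhabited X -> onto (fmapl F phi X : alg_hom _ _) -> onto phi])
      (* injectivity and surjectivity in the second argument *)
    & (forall (L : LatStar) (X Y : Rel tau) (p : rel_hom X Y),
         (injective p -> onto (fmapr F L p : alg_hom _ _)) /\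
         (onto p -> injective (fmapr F L p : alg_hom _ _)))].
Proof.
exists (complex_functor tau); split.
- by split.
- split=> [X K L P pr prP|X K L].
    exact: (alg_is_product (complex_lat_bij (lat_product_bij prP))).
  have bij (l : forall k, L k) : exists! f : lat_product L, forall k, lat_proj L k f = l k.
    exists l; split=> [//|f fl].
    by apply: functional_extensionality_dep => k; rewrite -fl.
  exists (alg_tuple (fun k => complex_hom (lat_proj L k) (rel_id X))); split=> //.
  exact: alg_tuple_iso (complex_lat_bij bij).
- split=> [L K X S inj injP|L K X].
    have [h [injK hK]] := rel_coproduct_bij injP.
    exact: (alg_is_product (complex_rel_bij (L := L) injK hK)).
  exists (alg_tuple (fun k => complex_hom (lat_id L) (rel_inj X k))); split=> //.
  (* The cotuple of the canonical injections is the identity, up to destructing the pair. *)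
  by apply: alg_tuple_iso; apply: (complex_rel_bij (h := id)) => -[].
- move=> L M phi X; split=> [phi_inj a b ab|phi_onto b|[x] F_inj a b ab|[x] F_onto b].
  + by apply/funext => x; apply: phi_inj; have := congr1 (fun f => f x) ab.
  + have [a aE] := choice (fun x => phi_onto (b x)).
    by exists a; apply/funext.
  (* Both converses test the hypothesis on constant functions and evaluate at the point [x]. *)
  + have := F_inj (fun=> a) (fun=> b); move/(_ (funext (fun=> ab))).
    exact: (congr1 (fun f => f x)).
  + have [a aE] := F_onto (fun=> b).
    by exists (a x); exact: (congr1 (fun f => f x) aE).
- move=> L X Y p; split=> [p_inj a|p_onto a b ab].
    (* The function [a] is transported to the image of [p] and extended by [\bot]; injectivity makes
       the chosen preimage of [p x] equal to [x]. *)
    exists (fun y => if pselect (exists x, p x = y) is left e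
                     then a (sval (cid e)) else \bot).
    apply/funext => x /=; case: pselect => [e|[]]; last by exists x.
    by congr a; apply: p_inj; exact: svalP (cid e).
  apply/funext => y; have [x <-] := p_onto y.
  exact: (congr1 (fun f => f x) ab).
Qed.
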